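(* Let $\alpha_x,\alpha_t\in\mathbb{R}$ with $\alpha_x\neq 0$, let $\nu$ be the kinematic viscosity, and let $\vec u(x,y,z,t)=(u,v,w)$ and $p(x,y,z,t)$ be (sufficiently smooth) functions satisfying the incompressible Navier--Stokes equations $$\frac{\partial \vec u}{\partial t}+(\vec u\cdot\nabla)\vec u=\nu\Delta\vec u-\nabla p,\qquad \nabla\cdot\vec u=0,$$ such that $u,v,w,p$ are relative invariant functions of the scaling transformation with exponents $\alpha_x,\alpha_t$. Then $u,v,w$ must be isobaric in $x,y,z$ and $t$ of weight $\alpha_x-\alpha_t$, and $p$ must be isobaric in $x,y,z$ and $t$ of weight $2(\alpha_x-\alpha_t)$, so that the Navier--Stokes system becomes $$\frac{\partial \vec u}{\partial t}+(\vec u\cdot\nabla)\vec u=\nu\Delta\vec u-\nabla p,\qquad \nabla\cdot\vec u=0,$$ $$(\vec r\cdot\nabla)\vec u+t\,\frac{\alpha_t}{\alpha_x}\frac{\partial\vec u}{\partial t}=\frac{\alpha_x-\alpha_t}{\alpha_x}\,\vec u,\qquad (\vec r\cdot\nabla)p+t\,\frac{\alpha_t}{\alpha_x}\frac{\partial p}{\partial t}=\frac{2(\alpha_x-\alpha_t)}{\alpha_x}\,p,$$ where $\vec r=(x,y,z)$ is the position vector.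
   Context: The symbol $p$ denotes pressure divided by the constant density. The general scaling transformation admitted by the Navier--Stokes equations (with zero gravity) is, for constants $0<k<\infty$, $$(x',y',z')=k^{\alpha_x}(x,y,z),\quad t'=k^{\alpha_t}t,\quad (u',v',w')=k^{\alpha_x-\alpha_t}(u,v,w),\quad p'=k^{2(\alpha_x-\alpha_t)}p,\quad \nu'=k^{2\alpha_x-\alpha_t}\nu .$$ A function $R(x,y,z,t)$ is a relative invariant if under this transformation of its arguments it transforms as $R'=fR$ with a factor $f$; for $u,v,w$ the factor is $f=k^{\alpha_x-\alpha_t}$ and for $p$ it is $f=k^{2(\alpha_x-\alpha_t)}$, i.e. $\vec u(k^{\alpha_x}x,k^{\alpha_x}y,k^{\alpha_x}z,k^{\alpha_t}t)=k^{\alpha_x-\alpha_t}\vec u(x,y,z,t)$ and $p(k^{\alpha_x}x,k^{\alpha_x}y,k^{\alpha_x}z,k^{\alpha_t}t)=k^{2(\alpha_x-\alpha_t)}p(x,y,z,t)$ for all $k>0$. Weights: $x^a,y^a,z^a$ have weight $a\alpha_x$ and $t^b$ has weight $b\alpha_t$; weights add under multiplication. A function $F(x,y,z,t)$ is isobaric of weight $W$ if it is homogeneous of total weight $W$ with respect to these weights, i.e. $F(k^{\alpha_x}x,k^{\alpha_x}y,k^{\alpha_x}z,k^{\alpha_t}t)=k^{W}F(x,y,z,t)$ for all $k>0$. *)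

(* Defs.v *)
From HB Require Import structures.
From mathcomp Require Import all_boot all_order all_algebra.
From mathcomp Require Import all_classical all_reals all_analysis.
Set Implicit Arguments.
Unset Strict Implicit.
Unset Printing Implicit Defensive.
Import Order.TTheory GRing.Theory Num.Theory.
Import numFieldNormedType.Exports.
Local Open Scope classical_set_scope.
Local Open Scope ring_scope.

Section NavierStokes.
Context {R : realType}.

(* (r, t) with r = (x, y, z) *)
Local Notation pt := ('rV[R]_3 * R)%type.

Section Derivatives.
Context {V : normedModType R}.

Definition dspace (j : 'I_3) (F : pt -> V) (q : pt) : V :=
  'D_((delta_mx 0 j, 0) : pt) F q.

Definition dtime (F : pt -> V) (q : pt) : V :=
  'D_((0, 1) : pt) F q.

(* (a . nabla) F at q, for a vector a *)
Definition advect (a : 'rV[R]_3) (F : pt -> V) (q : pt) : V :=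
  \sum_(j < 3) a 0 j *: dspace j F q.

Definition laplacian (F : pt -> V) (q : pt) : V :=
  \sum_(j < 3) dspace j (dspace j F) q.

End Derivatives.

Definition gradient (f : pt -> R) (q : pt) : 'rV[R]_3 :=
  \row_j dspace j f q.

Definition component (u : pt -> 'rV[R]_3) (i : 'I_3) : pt -> R :=
  fun q => u q 0 i.

Definition divergence (u : pt -> 'rV[R]_3) (q : pt) : R :=
  \sum_(j < 3) dspace j (component u j) q.

Definition navier_stokes (nu : R) (D : set pt)
    (u : pt -> 'rV[R]_3) (p : pt -> R) : Prop :=
  forall q : pt, D q ->
    dtime u q + advect (u q) u q = nu *: laplacian u q - gradient p q
    /\ divergence u q = 0.

(* The action of the scaling transformation on the arguments (x, y, z, t). *)
Definition scaling (alpha_x alpha_t k : R) (q : pt) : pt :=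
  (k `^ alpha_x *: q.1, k `^ alpha_t * q.2).

Definition scaling_stable (alpha_x alpha_t : R) (D : set pt) : Prop :=
  forall k : R, 0 < k -> forall q : pt, D q -> D (scaling alpha_x alpha_t k q).

(* F' = f F, with f depending on the parameter k of the transformation. *)
Definition relative_invariant (alpha_x alpha_t : R) (D : set pt) (f : R -> R)
    (F : pt -> R) : Prop :=
  forall k : R, 0 < k -> forall q : pt, D q ->
    F (scaling alpha_x alpha_t k q) = f k * F q.

Definition isobaric (alpha_x alpha_t : R) (D : set pt) (W : R) (F : pt -> R) : Prop :=
  forall k : R, 0 < k -> forall q : pt, D q ->
    F (scaling alpha_x alpha_t k q) = k `^ W * F q.

(* Regularity under which all derivatives in the system make sense and the
   chain rule applies; weaker than u of class C^2 and p of class C^1. *)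
Definition smooth_enough (D : set pt)
    (u : pt -> 'rV[R]_3) (p : pt -> R) : Prop :=
  forall q : pt, D q ->
    [/\ differentiable u q,
        forall j : 'I_3, differentiable (dspace j u) q
      & differentiable p q].

End NavierStokes.

(* Main.v *)
Require Import Defs.
From mathcomp Require Import all_boot all_order all_algebra.
From mathcomp Require Import all_classical all_reals all_analysis.
Import Order.TTheory GRing.Theory Num.Theory.
Import numFieldNormedType.Exports.
Local Open Scope classical_set_scope.
Local Open Scope ring_scope.

(** The statement is Euler's theorem on homogeneous functions, for the weights
    of the scaling group.  Fix a point [q = (r, t)] of the domain.  The orbit
    [k |-> (k^alpha_x r, k^alpha_t t)] passes through [q] at [k = 1] with
    velocity [(alpha_x r, alpha_t t)], so the chain rule gives the derivative
    at [k = 1] of a field [F] along the orbit as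
    [(alpha_x r . nabla) F + alpha_t t dF/dt].  If [F] is multiplied by [k^W]
    along the orbit, the same derivative is [W F].  Equating the two and
    dividing by [alpha_x] gives the additional equations ([euler_relation]),
    with [W = alpha_x - alpha_t] for the velocity and
    [W = 2 (alpha_x - alpha_t)] for the pressure.

    Isobarity of weight [W] is relative invariance with the factor [k^W]; for
    the velocity the three scalar laws combine into one law for the vector, to
    which the relation applies at once. *)

Section EulerRelation.
Context {R : realType} {V : normedModType R}.
Local Notation pt := ('rV[R]_3 * R)%type.
Implicit Types (F : pt -> V) (q : pt).

(** The derivatives in the equations are partial derivatives; they are the
    coordinates of the differential, which is where the chain rule takes
    place. *)
Lemma diff_advect_dtime F q (a : 'rV[R]_3) (b : R) : differentiable F q ->
  'd F q (a, b) = advect a F q + b *: dtime F q.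
Proof.
move=> dF; have -> : (a, b) =
    \sum_(j < 3) a 0 j *: ((delta_mx 0 j, 0) : pt) + b *: ((0, 1) : pt).
  apply/pair_equal_spec; split=> /=.
    rewrite raddf_sum /= scaler0 addr0 {1}(row_sum_delta a).
    exact: eq_bigr.
  rewrite raddf_sum /= big1 ?add0r => [|j _]; last by rewrite scaler0.
  exact/esym/mulr1.
rewrite linearD linearZ linear_sum /= /dtime deriveE//; congr (_ + _).
by apply: eq_bigr => j _; rewrite linearZ /= /dspace deriveE.
Qed.

Lemma is_diff_powR_scale {W : normedModType R} (a : R) (v : W) :
  is_diff (1 : R) (fun k => k `^ a *: v) (fun h => (h * a) *: v).
Proof.
have dpow : is_derive (1 : R) 1 ((@powR R)^~ a) a.
  apply: (is_derive_eq (is_derive1_powR a ltr01)).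
  by rewrite powR1 mulr1.
have dfpow : differentiable ((@powR R)^~ a) (1 : R).
  by apply/derivable1_diffP; case: dpow.
have ipow : is_diff (1 : R) ((@powR R)^~ a) (fun h => h * a).
  apply: DiffDef => //; rewrite diff1E// derive1E; apply/funext => h /=.
  by congr (_ * _); case: dpow.
exact: (is_diff_comp ipow (is_diff_scalel _ _)).
Qed.

Lemma is_diff_scaling (alpha_x alpha_t : R) q :
  is_diff (1 : R) (fun k => scaling alpha_x alpha_t k q)
    (fun h => ((h * alpha_x) *: q.1, (h * alpha_t) *: q.2)).
Proof.
exact: (is_diff_pair (is_diff_powR_scale alpha_x q.1)
                     (is_diff_powR_scale alpha_t (q.2 : R^o))).
Qed.

Lemma scaling1 (alpha_x alpha_t : R) q : scaling alpha_x alpha_t 1 q = q.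
Proof. by rewrite /scaling !powR1 scale1r mul1r; case: q. Qed.

(** Both sides of the isobarity equation are differentiated at [k = 1]; the
    equation holds only for [k > 0], which is a neighborhood of [1]. *)
Lemma diff_isobaric (alpha_x alpha_t W : R) F q : differentiable F q ->
  (forall k, 0 < k -> F (scaling alpha_x alpha_t k q) = k `^ W *: F q) ->
  'd F q (alpha_x *: q.1, alpha_t *: q.2) = W *: F q.
Proof.
move=> dF isoF; have dF1 : is_diff (scaling alpha_x alpha_t 1 q) F ('d F q).
  by rewrite scaling1; apply: DiffDef.
have lhs := is_diff_comp (is_diff_scaling alpha_x alpha_t q) dF1.
have rhs := is_diff_powR_scale W (F q).
have := @near_eq_derive _ _ _ (F \o (fun k => scaling alpha_x alpha_t k q))
  (fun k => k `^ W *: F q) 1 1.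
rewrite !deriveE; [|exact: (@ex_diff _ _ _ _ _ _ _ rhs)
                   |exact: (@ex_diff _ _ _ _ _ _ _ lhs)].
rewrite (@diff_val _ _ _ _ _ _ _ rhs) (@diff_val _ _ _ _ _ _ _ lhs) /= !mul1r.
apply; near=> k; apply: isoF; near: k.
exact: (lt_nbhsr ltr01).
Unshelve. all: by end_near. Qed.

Lemma euler_relation (alpha_x alpha_t W : R) F (r : 'rV[R]_3) (t : R) :
  alpha_x != 0 -> differentiable F (r, t) ->
  (forall k, 0 < k ->
     F (scaling alpha_x alpha_t k (r, t)) = k `^ W *: F (r, t)) ->
  advect r F (r, t) + (t * (alpha_t / alpha_x)) *: dtime F (r, t)
  = (W / alpha_x) *: F (r, t).
Proof.
move=> ax0 dF isoF; have /= dFq := diff_isobaric _ _ _ _ _ dF isoF.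
rewrite -diff_advect_dtime// [W / _]mulrC -scalerA -dFq -linearZ /=.
congr ('d F (r, t) _); apply/pair_equal_spec; split=> /=.
  by rewrite scalerA mulVf// scale1r.
by rewrite -[RHS]/(alpha_x^-1 * (alpha_t * t)) mulrC [alpha_t / _]mulrC mulrA.
Qed.

End EulerRelation.

Theorem theorem3p4 (R : realType) (alpha_x alpha_t nu : R) (D : set ('rV[R]_3 * R))
    (u : 'rV[R]_3 * R -> 'rV[R]_3) (p : 'rV[R]_3 * R -> R)
    (alpha_x_neq0 : alpha_x != 0)
    (D_open : open D) (D_stable : scaling_stable alpha_x alpha_t D)
    (up_smooth : smooth_enough D u p)
    (up_NS : navier_stokes nu D u p)
    (u_inv : forall i : 'I_3,
       relative_invariant alpha_x alpha_t D (fun k => k `^ (alpha_x - alpha_t)) (component u i))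
    (p_inv : relative_invariant alpha_x alpha_t D (fun k => k `^ (2 * (alpha_x - alpha_t))) p) :
  [/\ forall i : 'I_3, isobaric alpha_x alpha_t D (alpha_x - alpha_t) (component u i),
      isobaric alpha_x alpha_t D (2 * (alpha_x - alpha_t)) p,
      navier_stokes nu D u p,
      forall (r : 'rV[R]_3) (t : R), D (r, t) ->
        advect r u (r, t) + (t * (alpha_t / alpha_x)) *: dtime u (r, t)
        = ((alpha_x - alpha_t) / alpha_x) *: u (r, t)
    & forall (r : 'rV[R]_3) (t : R), D (r, t) ->
        advect r p (r, t) + t * (alpha_t / alpha_x) * dtime p (r, t)
        = (2 * (alpha_x - alpha_t)) / alpha_x * p (r, t)].
Proof.
split=> //.
- move=> r t Drt; have [du _ _] := up_smooth _ Drt.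
  apply: euler_relation => // k k0.
  by apply/rowP => i; rewrite mxE; exact: u_inv.
- move=> r t Drt; have [_ _ dp] := up_smooth _ Drt.
  (* In [R^o] scaling is multiplication. *)
  apply: (euler_relation _ _ _ (p : _ -> R^o)) => // k k0; exact: p_inv.
Qed.
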